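(* Let $T,S\in\mathbb{B}_{A^{1/2}}(\mathcal{H})$ and $\varepsilon\in[0,1)$. Then $T\perp^B_{A,\varepsilon}S$ if and only if for each $\alpha\in[0,2\pi)$ there exists a sequence $\{x_n^{\alpha}\}\subseteq\mathbb{S}_{\mathcal{H}}^A$ such that the following conditions hold: (i) $\lim_{n\to\infty}\|Tx_n^{\alpha}\|_A=\|T\|_A$; (ii) $\lim_{n\to\infty}\operatorname{Re}\big(e^{-i\alpha}\langle Tx_n^{\alpha},Sx_n^{\alpha}\rangle_A\big)\ge-\varepsilon\|T\|_A\|S\|_A$ (in particular, this limit exists).
   Context: $\mathcal{H}$ is a complex Hilbert space with inner product $\langle\cdot,\cdot\rangle$, $\mathbb{B}(\mathcal{H})$ is the algebra of bounded linear operators on $\mathcal{H}$, and $A\in\mathbb{B}(\mathcal{H})$ is a fixed non-zero positive operator ($\langle Ax,x\rangle\ge 0$ for all $x$; $A$ need not be injective). Put $\langle x,y\rangle_A=\langle Ax,y\rangle$, $\|x\|_A=\sqrt{\langle x,x\rangle_A}$ and $\mathbb{S}_{\mathcal{H}}^A=\{x\in\mathcal{H}:\|x\|_A=1\}$. $\mathbb{B}_{A^{1/2}}(\mathcal{H})$ is the set of $T\in\mathbb{B}(\mathcal{H})$ for which there is $c>0$ with $\|Tx\|_A\le c\|x\|_A$ for all $x\in\mathcal{H}$; for such $T$, $\|T\|_A=\sup\{\|Tx\|_A: x\in\mathbb{S}_{\mathcal{H}}^A\}<\infty$. For $T,S\in\mathbb{B}_{A^{1/2}}(\mathcal{H})$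 and $\varepsilon\in[0,1)$, $T\perp^B_{A,\varepsilon}S$ means that $\|T+\lambda S\|_A^2\ge\|T\|_A^2-2\varepsilon\|T\|_A\|\lambda S\|_A$ for all $\lambda\in\mathbb{C}$. *)

(* Defs.v *)
From mathcomp Require Export all_boot all_order all_algebra.
From mathcomp Require Export sesquilinear.
From mathcomp Require Export all_classical all_reals all_analysis.
From mathcomp Require Export complex.

Set Implicit Arguments.
Unset Strict Implicit.
Unset Printing Implicit Defensive.

Export Order.TTheory GRing.Theory Num.Theory.
Export numFieldNormedType.Exports.

Local Open Scope classical_set_scope.
Local Open Scope ring_scope.
Local Open Scope complex_scope.

(* A complex Hilbert space over [R[i]] is a complete normed module [H] together
   with a positive definite hermitian form [ip], linear in its first argument
   and conjugate-linear in its second, that induces the norm of [H].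
   Norms in [H] take their values in [R[i]], hence the cast [%:C] below. *)

Definition norm_induced (R : realType) (H : completeNormedModType R[i])
    (ip : {dot H for Num.conj}) : Prop :=
  forall x : H, `|x| ^+ 2 = ip x x.

Definition bounded_op (R : realType) (H : completeNormedModType R[i])
    (T : {linear H -> H}) : Prop :=
  exists c : R, forall x : H, `|T x| <= c%:C * `|x|.

(* In [R[i]], [0 <= z] says that [z] is real and nonnegative. *)
Definition positive_op (R : realType) (H : completeNormedModType R[i])
    (ip : {dot H for Num.conj}) (A : {linear H -> H}) : Prop :=
  forall x : H, 0 <= ip (A x) x.

Definition cis (R : realType) (t : R) : R[i] := cos t +i* sin t.

Section SemiHilbert.
Variables (R : realType) (H : completeNormedModType R[i]).
Variables (ip : {dot H for Num.conj}) (A : {linear H -> H}).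

Definition ipA (x y : H) : R[i] := ip (A x) y.

Definition normA (x : H) : R := Num.sqrt (complex.Re (ipA x x)).

Definition sphereA : set H := [set x | normA x = 1].

Definition Abounded (T : {linear H -> H}) : Prop :=
  bounded_op T /\
  exists2 c : R, 0 < c & forall x : H, normA (T x) <= c * normA x.

(* This is the A-operator norm only where the supremum is finite, in particular
   on the algebra of [Abounded] operators when A is positive and nonzero. *)
Definition opnormA (T : H -> H) : R := sup [set normA (T x) | x in sphereA].

Definition approx_orthoA (eps : R) (T S : {linear H -> H}) : Prop :=
  forall l : R[i],
    opnormA (T \+ l \*: S) ^+ 2 >=
      opnormA T ^+ 2 - 2 * eps * opnormA T * opnormA (l \*: S).

End SemiHilbert.

(* Main.v *)
(** Everything rests on the expansion
      |Tx + r e^{it} Sx|_A^2 = |Tx|_A^2 + 2 r Re(e^{-it} <Tx, Sx>_A) + r^2 |Sx|_A^2.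
    If T is approximately orthogonal to S, unit vectors that nearly maximize
    T + r e^{it} S are, as r -> 0, maximizing for T, and dividing by 2 r bounds
    the cross term from below in the limit; it is bounded, so it converges along
    a subsequence. No convexity of a numerical range is needed, because the
    sequence may depend on the direction t. Conversely, writing a scalar as
    r e^{it} and passing to the limit in the expansion along the given sequence
    yields the orthogonality inequality. *)
Require Import Defs.
From mathcomp Require Import ring lra.
Local Open Scope classical_set_scope.
Local Open Scope ring_scope.
Local Open Scope complex_scope.

(** * Polar decomposition of scalars, and limits along subsequences *)

Lemma polar_form (R : realType) (z : R[i]) :
  exists r t : R, [/\ 0 <= r, 0 <= t, t < 2 * pi & z = r%:C * cis t].
Proof.
case: z => a b; pose r := Num.sqrt (a ^+ 2 + b ^+ 2).
have r2 : r ^+ 2 = a ^+ 2 + b ^+ 2 by rewrite sqr_sqrtr // addr_ge0 ?sqr_ge0.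
have r0 : 0 <= r by exact: sqrtr_ge0.
have pi0 : 0 < pi :> R := pi_gt0 R.
have [r_eq0|r_neq0] := eqVneq r 0.
  exists 0, 0; split=> //; first by rewrite mulr_gt0.
  have : a = 0 /\ b = 0.
    move: r2; rewrite r_eq0 expr0n /= => /esym /eqP.
    by rewrite paddr_eq0 ?sqr_ge0 // !sqrf_eq0 => /andP[/eqP-> /eqP->].
  by case=> -> ->; rewrite mul0r.
have rgt0 : 0 < r by rewrite lt_neqAle eq_sym r_neq0.
pose c := a / r; pose s := b / r.
have aE : a = r * c by rewrite /c mulrC divfK.
have bE : b = r * s by rewrite /s mulrC divfK.
have cs1 : c ^+ 2 + s ^+ 2 = 1.
  by rewrite /c /s !expr_div_n -mulrDl -r2 divff // expf_neq0.
have c1 : -1 <= c <= 1 by apply/andP; split; nra.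
have cP : c \in `[(-1), 1] by rewrite in_itv.
have sE : Num.sqrt (1 - c ^+ 2) = `|s| by rewrite -cs1 addrC addKr sqrtr_sqr.
have [s0|s0] := leP 0 s.
  exists r, (acos c); split => //; first exact: acos_ge0.
    by apply: le_lt_trans (acos_lepi c1) _; lra.
  rewrite /cis acosK // sin_acos // sE ger0_norm //.
  by apply/eqP; rewrite eq_complex /= -aE -bE !mul0r subr0 addr0 !eqxx.
(* [acos] only reaches the upper half circle, so the angle is reflected; [s < 0] forces [c < 1],
   which keeps it strictly below [2 * pi]. *)
exists r, (2 * pi - acos c); have ? := acos_lepi c1.
split => //; first by lra.
  suff : 0 < acos c by lra.
  apply: acos_gt0; nra.
rewrite /cis mulr_natl cosB sinB cos2pi sin2pi acosK // sin_acos // sE ltr0_norm //.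
apply/eqP; rewrite eq_complex /= -/c.
by apply/andP; split; apply/eqP; rewrite ?aE ?bE; ring.
Qed.

Lemma increasing_seq_cvg (f : nat -> nat) : increasing_seq f -> f @ \oo --> \oo.
Proof.
move=> /increasing_seqP f_incr; apply/cvgnyPge => N.
have f_ge n : (n <= f n)%N.
  by elim: n => // n IH; apply: leq_ltn_trans IH _; exact: f_incr.
by exists N => // n /= Nn; apply: leq_trans Nn _.
Qed.

(** * The semi-inner product of a positive operator and its seminorm *)

Section SemiHilbertTheory.
Set Implicit Arguments.
Unset Strict Implicit.
Variables (R : realType) (H : completeNormedModType R[i]).
Variables (ip : {dot H for Num.conj}) (A : {linear H -> H}).
Hypothesis A_pos : positive_op ip A.

Local Notation ipA := (ipA ip A).
Local Notation normA := (normA ip A).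
Local Notation opnormA := (opnormA ip A).
Local Notation sphereA := (sphereA ip A).

Lemma ipADl x y z : ipA (x + y) z = ipA x z + ipA y z.
Proof. by rewrite /Defs.ipA linearD linearDl. Qed.

Lemma ipADr x y z : ipA x (y + z) = ipA x y + ipA x z.
Proof. by rewrite /Defs.ipA linearDr. Qed.

Lemma ipAZl c x y : ipA (c *: x) y = c * ipA x y.
Proof. by rewrite /Defs.ipA linearZ linearZl_LR. Qed.

Lemma ipAZr c x y : ipA x (c *: y) = c^* * ipA x y.
Proof. by rewrite /Defs.ipA linearZr_LR. Qed.

Lemma Im_ipA x : complex.Im (ipA x x) = 0.
Proof. by have := A_pos x; rewrite lecE => /andP[/eqP]. Qed.

Lemma Re_ipA_ge0 x : 0 <= complex.Re (ipA x x).
Proof. by have := A_pos x; rewrite lecE => /andP[]. Qed.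

(* Polarization: [ipA (x + 'i y) (x + 'i y)] is real. *)
Lemma Re_ipAC x y : complex.Re (ipA y x) = complex.Re (ipA x y).
Proof.
have := Im_ipA (x + 'i *: y).
rewrite ipADl !ipADr !ipAZl !ipAZr.
have := Im_ipA x; have := Im_ipA y.
case: (ipA x x) (ipA y y) (ipA x y) (ipA y x) => [a b] [c d] [e f] [g h] /=.
lra.
Qed.

Lemma sqr_normA x : normA x ^+ 2 = complex.Re (ipA x x).
Proof. by rewrite sqr_sqrtr // Re_ipA_ge0. Qed.

Lemma normA_ge0 x : 0 <= normA x.
Proof. exact: sqrtr_ge0. Qed.

Lemma sqr_normAD x y :
  normA (x + y) ^+ 2 = normA x ^+ 2 + normA y ^+ 2 + 2 * complex.Re (ipA x y).
Proof.
rewrite !sqr_normA ipADl !ipADr !raddfD /= (Re_ipAC x y); ring.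
Qed.

Lemma normAZ r t x : 0 <= r -> normA ((r%:C * cis t) *: x) = r * normA x.
Proof.
move=> r0; apply/eqP.
rewrite -(eqrXn2 (ltn0Sn 1)) ?mulr_ge0 ?normA_ge0 //; apply/eqP.
rewrite exprMn !sqr_normA ipAZl ipAZr; have := Im_ipA x.
case: (ipA x x) => a b /= ->.
have : cos t ^+ 2 = 1 - sin t ^+ 2 by rewrite -(cos2Dsin2 t) addrK.
move: (cos t) (sin t) => c s cs.
transitivity (r ^+ 2 * (c ^+ 2 + s ^+ 2) * a); first by ring.
by rewrite cs; ring.
Qed.

(** Conjugate-linearity in the second argument turns [cis t] into [cis (- t)], the rotation of the
    limit condition. *)
Lemma Re_ipAZr r t x y :
  complex.Re (ipA x ((r%:C * cis t) *: y)) = r * complex.Re (cis (- t) * ipA x y).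
Proof.
rewrite ipAZr /cis cosN sinN; case: (ipA x y) => a b /=; ring.
Qed.

(** Expand the nonnegative forms at [x + y] and [x - y]. This takes the place of Cauchy-Schwarz in
    bounding cross terms. *)
Lemma normr_Re_ipA x y :
  2 * `|complex.Re (ipA x y)| <= normA x ^+ 2 + normA y ^+ 2.
Proof.
have := Re_ipA_ge0 (x + y); have := Re_ipA_ge0 (x - y).
rewrite -scaleN1r !sqr_normA !ipADl !ipADr !ipAZl !ipAZr rmorphN rmorph1.
have := Re_ipAC x y.
case: (ipA x x) (ipA y y) (ipA x y) (ipA y x) => [a b] [c d] [e f] [g h] /=.
by case: ler0P; lra.
Qed.

Lemma normr_Re_cis_ipA t x y :
  2 * `|complex.Re (cis (- t) * ipA x y)| <= normA x ^+ 2 + normA y ^+ 2.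
Proof.
have := normr_Re_ipA x ((1%:C * cis t) *: y).
by rewrite Re_ipAZr normAZ ?ler01 // !mul1r.
Qed.

(** If the seminorm vanished everywhere, expanding it at [x + A x] would leave [ip (A x) (A x) = 0],
    hence [A x = 0]. Otherwise normalize. *)
Lemma sphereA_nonempty : (exists x, A x != 0) -> exists x, sphereA x.
Proof.
case=> x Ax0.
suff [y qy] : exists y, normA y != 0.
  have y0 : 0 < normA y by rewrite lt_neqAle eq_sym qy normA_ge0.
  exists (((normA y)^-1%:C * cis 0) *: y).
  by rewrite /Defs.sphereA /= normAZ ?invr_ge0 ?normA_ge0 // mulVf.
apply: contrapT => q0.
have {}q0 y : normA y = 0 by apply/eqP/negPn/negP => qy; apply: q0; exists y.
have := sqr_normAD x (A x); rewrite !q0 !expr0n /= !add0r => /esym/eqP.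
rewrite mulf_eq0 pnatr_eq0 /= /Defs.ipA => /eqP Re0.
have : 0 < ip (A x) (A x) by rewrite dnorm_gt0.
by rewrite ltcE Re0 ltxx andbF.
Qed.

(** Makes the supremum in [opnormA] an upper bound; stated for plain functions so as to cover
    [T \+ l \*: S]. *)
Definition sphere_bounded (T : H -> H) : Prop :=
  exists c : R, forall x, sphereA x -> normA (T x) <= c.

Lemma sphere_bounded_Abounded (T : {linear H -> H}) :
  Abounded ip A T -> sphere_bounded T.
Proof.
case=> _ [c _ Tc]; exists c => x xS; apply: le_trans (Tc x) _.
by rewrite xS mulr1.
Qed.

Lemma sphere_bounded_pencil (T S : H -> H) (l : R[i]) :
  sphere_bounded T -> sphere_bounded S -> sphere_bounded (T \+ l \*: S).
Proof.
case=> c Tc [d Sd]; have [r [t [r0 _ _ ->]]] := polar_form _ l.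
(* The constant comes from |u + v|^2 <= 2 |u|^2 + 2 |v|^2. *)
exists (Num.sqrt (2 * c ^+ 2 + 2 * (r * d) ^+ 2)) => x xS.
rewrite -(ger0_norm (normA_ge0 _)) -sqrtr_sqr ler_wsqrtr //=.
have := normr_Re_ipA (T x) ((r%:C * cis t) *: S x).
rewrite sqr_normAD normAZ //.
have : normA (T x) ^+ 2 <= c ^+ 2.
  by rewrite lerXn2r ?nnegrE ?normA_ge0 ?(le_trans _ (Tc x xS)) ?normA_ge0 // Tc.
have : (r * normA (S x)) ^+ 2 <= (r * d) ^+ 2.
  rewrite lerXn2r ?nnegrE ?mulr_ge0 ?normA_ge0 ?(le_trans _ (Sd x xS)) //.
    exact: normA_ge0.
  by rewrite ler_wpM2l // Sd.
by have := ler_norm (complex.Re (ipA (T x) ((r%:C * cis t) *: S x))); lra.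
Qed.

(** * The operator seminorm as a supremum over a nonempty sphere *)

Section Nonempty.
Hypothesis A_neq0 : exists x, A x != 0.

Lemma le_opnormA (T : H -> H) x :
  sphere_bounded T -> sphereA x -> normA (T x) <= opnormA T.
Proof.
case=> c Tc xS; apply: ub_le_sup; last by exists x.
by exists c => _ [y yS <-]; exact: Tc.
Qed.

Lemma opnormA_le (T : H -> H) c :
  (forall x, sphereA x -> normA (T x) <= c) -> opnormA T <= c.
Proof.
move=> Tc; apply: ge_sup; last by move=> _ [x xS <-]; exact: Tc.
by have [x xS] := sphereA_nonempty A_neq0; exists (normA (T x)), x.
Qed.

Lemma opnormA_ge0 (T : H -> H) : sphere_bounded T -> 0 <= opnormA T.
Proof.
have [x xS] := sphereA_nonempty A_neq0.
by move=> Tb; apply: le_trans (le_opnormA Tb xS); exact: normA_ge0.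
Qed.

Lemma opnormAZ (r t : R) (S : H -> H) :
  0 <= r -> sphere_bounded S -> opnormA ((r%:C * cis t) \*: S) = r * opnormA S.
Proof.
move=> r0 Sb; apply/eqP; rewrite eq_le; apply/andP; split.
  apply: opnormA_le => x xS /=; rewrite normAZ // ler_wpM2l //.
  exact: le_opnormA.
have rSb : sphere_bounded ((r%:C * cis t) \*: S).
  case: Sb => c Sc; exists (r * c) => x xS /=.
  by rewrite normAZ // ler_wpM2l // Sc.
have [r_eq0|r_neq0] := eqVneq r 0.
  by rewrite {1}r_eq0 mul0r; exact: opnormA_ge0.
have {r_neq0}r_gt0 : 0 < r by rewrite lt_neqAle eq_sym r_neq0.
rewrite mulrC -ler_pdivlMr //; apply: opnormA_le => x xS.
rewrite ler_pdivlMr // mulrC -(normAZ t _ r0).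
exact: (le_opnormA rSb xS).
Qed.

Lemma opnormA_adherent (T : H -> H) e : 0 < e ->
  exists2 x, sphereA x & opnormA T ^+ 2 - e < normA (T x) ^+ 2.
Proof.
move=> e0; apply: contrapT => noT.
have Te x : sphereA x -> normA (T x) ^+ 2 <= opnormA T ^+ 2 - e.
  by move=> xS; rewrite leNgt; apply/negP => ?; apply: noT; exists x.
(* A point of the sphere shows that the bound is nonnegative, so that squaring undoes [Num.sqrt],
   which is 0 on negative numbers. *)
have [x xS] := sphereA_nonempty A_neq0.
have K0 : 0 <= opnormA T ^+ 2 - e by apply: le_trans (sqr_ge0 _) (Te _ xS).
have : opnormA T <= Num.sqrt (opnormA T ^+ 2 - e).
  apply: opnormA_le => y yS.
  by rewrite -(ger0_norm (normA_ge0 _)) -sqrtr_sqr ler_wsqrtr // Te.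
have T0 : 0 <= opnormA T.
  apply: opnormA_ge0; exists (Num.sqrt (opnormA T ^+ 2 - e)) => y yS.
  by rewrite -(ger0_norm (normA_ge0 _)) -sqrtr_sqr ler_wsqrtr // Te.
rewrite -(ler_sqr T0) ?nnegrE ?sqrtr_ge0 // sqr_sqrtr //; lra.
Qed.

(* With [l = r cis t], a near maximizer of [T + l S] nearly maximizes [T] up to
   [O(r)]; dividing its expansion by [2 r] bounds the cross term from below. *)
Lemma approx_orthoA_near_maximizer (T S : {linear H -> H}) eps t r :
  sphere_bounded T -> sphere_bounded S -> 0 <= eps -> 0 < r <= 1 ->
  approx_orthoA ip A eps T S ->
  exists x, [/\ sphereA x,
    opnormA T ^+ 2 - r * (2 * eps * opnormA T * opnormA S + 1 +
      2 * opnormA S ^+ 2 + opnormA T ^+ 2) <= normA (T x) ^+ 2 &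
    - eps * opnormA T * opnormA S - r * (1 + opnormA S ^+ 2) <=
      complex.Re (cis (- t) * ipA (T x) (S x))].
Proof.
move=> Tb Sb eps0 /andP[r0 r1] /(_ (r%:C * cis t)).
rewrite opnormAZ ?(ltW r0) // => orth.
(* The slack [r ^+ 2] is still O(r) after division by [2 * r]. *)
have [|x xS] := @opnormA_adherent (T \+ (r%:C * cis t) \*: S) (r ^+ 2).
  by rewrite exprn_gt0.
rewrite /= sqr_normAD normAZ ?(ltW r0) // Re_ipAZr => xmax.
exists x; split=> //.
all: have TxT : normA (T x) ^+ 2 <= opnormA T ^+ 2
  by rewrite lerXn2r ?nnegrE ?normA_ge0 ?opnormA_ge0 ?le_opnormA.
all: have SxS : normA (S x) ^+ 2 <= opnormA S ^+ 2
  by rewrite lerXn2r ?nnegrE ?normA_ge0 ?opnormA_ge0 ?le_opnormA.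
all: have M0 := opnormA_ge0 Tb; have N0 := opnormA_ge0 Sb.
all: have := normr_Re_cis_ipA t (T x) (S x).
all: move: orth xmax TxT SxS; rewrite exprMn.
all: move: (complex.Re _) (opnormA (_ \+ _) ^+ 2) (normA (T x) ^+ 2) => b K q1.
all: have := sqr_ge0 (normA (S x)); move: (normA (S x) ^+ 2) => q2.
all: move: (opnormA T) (opnormA S) M0 N0 => M N M0 N0 q20 orth xmax TxT SxS bb.
all: have rr : r ^+ 2 <= r by rewrite expr2 ler_piMr // ltW.
all: have rq : r ^+ 2 * q2 <= r ^+ 2 * N ^+ 2 by rewrite ler_wpM2l ?sqr_ge0.
  (* First bound: solve the expansion for [q1], absorbing every [r ^+ 2] into [r]. *)
  have : r ^+ 2 * N ^+ 2 <= r * N ^+ 2 by rewrite ler_wpM2r ?sqr_ge0.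
  have : r * (2 * b) <= r * (M ^+ 2 + N ^+ 2).
    rewrite ler_wpM2l ?(ltW r0) //.
    by have := ler_norm b; lra.
  lra.
(* Second bound: [q1 <= M ^+ 2] cancels [M ^+ 2], leaving a lower bound for [r * b]. *)
rewrite -(ler_pM2l r0).
have : 0 <= r ^+ 2 * N ^+ 2 by rewrite mulr_ge0 ?sqr_ge0.
have := sqr_ge0 r.
lra.
Qed.

End Nonempty.
End SemiHilbertTheory.

Theorem theorem2p2 (R : realType) (H : completeNormedModType R[i])
    (ip : {dot H for Num.conj}) (ip_norm : norm_induced ip)
    (A : {linear H -> H}) (A_bounded : bounded_op A)
    (A_pos : positive_op ip A) (A_neq0 : exists x : H, A x != 0)
    (T S : {linear H -> H}) (hT : Abounded ip A T) (hS : Abounded ip A S)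
    (eps : R) (eps_ge0 : 0 <= eps) (eps_lt1 : eps < 1) :
  approx_orthoA ip A eps T S <->
  (forall alpha : R, 0 <= alpha -> alpha < 2 * pi ->
    exists x : nat -> H,
      [/\ forall n, sphereA ip A (x n),
          (fun n => normA ip A (T (x n))) @ \oo --> opnormA ip A T &
          exists2 L : R,
            (fun n => complex.Re (cis (- alpha) * ipA ip A (T (x n)) (S (x n))))
              @ \oo --> L &
            - eps * opnormA ip A T * opnormA ip A S <= L]).
Proof.
have Tb := sphere_bounded_Abounded hT; have Sb := sphere_bounded_Abounded hS.
have M0 := opnormA_ge0 A_pos A_neq0 Tb; have N0 := opnormA_ge0 A_pos A_neq0 Sb.
split=> [orth t _ _ | seqs l].
  (* The radii are 1/(n+1): they tend to 0 and stay in the range of the near-maximizer lemma. *)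
  have hr n : 0 < (harmonic n : R) <= 1.
    by rewrite harmonic_gt0 /= invf_le1 // ler1n.
  have [y yP] := choice (fun n => approx_orthoA_near_maximizer
    A_pos A_neq0 t Tb Sb eps_ge0 (hr n) orth).
  pose b n := complex.Re (cis (- t) * ipA ip A (T (y n)) (S (y n))).
  have yT n : normA ip A (T (y n)) <= opnormA ip A T.
    by have [yS _ _] := yP n; apply: le_opnormA.
  have yS n : normA ip A (S (y n)) <= opnormA ip A S.
    by have [yS _ _] := yP n; apply: le_opnormA.
  have rC0 (a C : R) : (fun n => a - harmonic n * C) @ \oo --> a.
    rewrite -[X in _ --> X]subr0 -(mul0r C).
    apply: cvgB; first exact: cvg_cst.
    by apply: cvgM; [exact: cvg_harmonic | exact: cvg_cst].
  have Tlim : (fun n => normA ip A (T (y n))) @ \oo --> opnormA ip A T.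
    have T2lim : (fun n => normA ip A (T (y n)) ^+ 2) @ \oo --> opnormA ip A T ^+ 2.
      set C := 2 * eps * opnormA ip A T * opnormA ip A S + 1 +
        2 * opnormA ip A S ^+ 2 + opnormA ip A T ^+ 2 in yP.
      apply: squeeze_cvgr (rC0 _ C) (cvg_cst _); near=> n.
      have [_ -> _] := yP n.
      by rewrite lerXn2r ?nnegrE ?normA_ge0.
    rewrite -(ger0_norm M0) -sqrtr_sqr.
    under eq_fun do rewrite -(ger0_norm (normA_ge0 _ _ _)) -sqrtr_sqr.
    exact: (cvg_comp _ _ T2lim (@sqrt_continuous R _)).
  (* The lower bounds alone do not make [b] converge; boundedness gives a convergent subsequence,
     along which the other limits persist. *)
  have [|f /increasing_seq_cvg f_oo /cvg_ex[L bL]] := bolzano_weierstrass (u_ := b).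
    exists (opnormA ip A T ^+ 2 + opnormA ip A S ^+ 2); split; first exact: num_real.
    move=> K ltK n _ /=; apply: le_trans (ltW ltK).
    have := normr_Re_cis_ipA A_pos t (T (y n)) (S (y n)); rewrite -/(b n).
    have : normA ip A (T (y n)) ^+ 2 <= opnormA ip A T ^+ 2.
      by rewrite lerXn2r ?nnegrE ?normA_ge0.
    have : normA ip A (S (y n)) ^+ 2 <= opnormA ip A S ^+ 2.
      by rewrite lerXn2r ?nnegrE ?normA_ge0.
    have := normr_ge0 (b n); lra.
  exists (y \o f); split.
  - by move=> n; have [] := yP (f n).
  - exact: (cvg_comp _ _ f_oo Tlim).
  - exists L => //.
    apply: ler_cvg_to
      (cvg_comp _ _ f_oo (rC0 _ (1 + opnormA ip A S ^+ 2))) bL _.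
    by near=> n; have [_ _] := yP (f n).
(* Converse: use the sequence attached to the argument [t] of the scalar. *)
have [r [t [r0 t0 t2pi ->]]] := polar_form _ l.
have [x [xS Tlim [L bL leL]]] := seqs t t0 t2pi.
rewrite opnormAZ //.
apply: (@le_trans _ _ (opnormA ip A T ^+ 2 + 2 * (r * L))).
  rewrite -subr_ge0.
  suff : 0 <= 2 * (r * (L - - eps * opnormA ip A T * opnormA ip A S)) by lra.
  by rewrite !mulr_ge0 // subr_ge0.
set K := opnormA ip A (_ \+ _).
have lim : (fun n => normA ip A (T (x n)) ^+ 2 + 2 * (r * complex.Re
      (cis (- t) * ipA ip A (T (x n)) (S (x n))))) @ \oo -->
    opnormA ip A T ^+ 2 + 2 * (r * L).
  apply: cvgD; first exact: cvgM.
  by apply: cvgM; [exact: cvg_cst | apply: cvgM => //; exact: cvg_cst].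
(* Each term is at most [K ^+ 2], since the expansion only adds the nonnegative square of the
   seminorm of [l *: S (x n)]. *)
apply: cvgr_to_le lim _; near=> n.
have TSb := sphere_bounded_pencil A_pos (r%:C * cis t) Tb Sb.
have : normA ip A (T (x n) + (r%:C * cis t) *: S (x n)) ^+ 2 <= K ^+ 2.
  by rewrite lerXn2r ?nnegrE ?normA_ge0 ?opnormA_ge0 //; exact: (le_opnormA TSb).
rewrite sqr_normAD // Re_ipAZr.
have := sqr_ge0 (normA ip A ((r%:C * cis t) *: S (x n))); lra.
Unshelve. all: by end_near.
Qed.
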